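(* Let $B=(b_{ij})$ be an $n\times n$ nonnegative matrix. For each $i\in\{1,2,\ldots,n\}$ let $l_i$ be the number of nonzero off-diagonal entries in the $i$th row of $B$, i.e. $l_i=|\{j\in\{1,\ldots,n\}\setminus\{i\} : b_{ij}\neq 0\}|$. Let $X=(x_1,x_2,\ldots,x_n)^T$ be an eigenvector of $B$ corresponding to the eigenvalue $\rho(B)$. Then $$\rho(B)\leq \max_{1\leq i\leq n}\Bigg\{b_{ii}+\sqrt{\sum_{k=1,\,k\neq i}^{n} l_k b_{ki}^2}\Bigg\}.$$ Moreover, if equality holds in this inequality, then $$b_{ii}+\sqrt{\sum_{k=1,\,k\neq i}^{n} l_k b_{ki}^2}=b_{jj}+\sqrt{\sum_{k=1,\,k\neq j}^{n} l_k b_{kj}^2}$$ for any $i,j\in\{s : x_s\neq 0,\ 1\leq s\leq n\}$. Furthermore, if $B$ is irreducible and equality holds in the inequality, then $$b_{ii}+\sqrt{\sum_{k=1,\,k\neq i}^{n} l_k b_{ki}^2}=b_{jj}+\sqrt{\sum_{k=1,\,k\neq j}^{n} l_k b_{kj}^2}$$ for any $i,j\in\{1,2,\ldots,n\}$.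
   Context: The spectral radius $\rho(M)$ of a square matrix $M$ is the largest modulus of its eigenvalues. A nonnegative matrix is a real matrix with all entries $\geq 0$; by the Perron–Frobenius theorem, $\rho(B)$ is an eigenvalue of a nonnegative matrix $B$. *)

(* Defs.v *)
From HB Require Import structures.
From mathcomp Require Export all_boot all_order all_algebra.
From mathcomp Require Export complex reals.

Set Implicit Arguments.
Unset Strict Implicit.
Unset Printing Implicit Defensive.

Import Order.TTheory GRing.Theory Num.Theory.

Local Open Scope ring_scope.
Local Open Scope complex_scope.

Section SpectralRadius.
Variables (R : realType) (n : nat).
Implicit Type M : 'M[R[i]]_n.

(* The eigenvalues of M, repeated according to algebraic multiplicity. *)
Definition spectrum M : seq R[i] :=
  sval (closed_field_poly_normal (char_poly M)).

Lemma mem_spectrum M a : (a \in spectrum M) = eigenvalue M a.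
Proof.
rewrite eigenvalue_root_char /spectrum.
case: closed_field_poly_normal => /= r.
rewrite (monicP (char_poly_monic M)) scale1r => ->.
by rewrite root_prod_XsubC.
Qed.

(* Moduli are nonnegative, so starting the maximum at 0 is harmless when n > 0;
   for n = 0 the value is 0. *)
Definition spectral_radius M : R :=
  \big[Num.max/0]_(a <- spectrum M) ComplexField.Normc.normc a.

Lemma spectral_radius_ge M a :
  eigenvalue M a -> ComplexField.Normc.normc a <= spectral_radius M.
Proof.
rewrite -mem_spectrum /spectral_radius.
elim: (spectrum M) => // b s IHs; rewrite inE big_cons le_max.
by case/predU1P => [-> | /IHs ->]; rewrite ?lexx ?orbT.
Qed.

Lemma spectral_radius_attained M :
  (0 < n)%N ->
  exists2 a, eigenvalue M a & ComplexField.Normc.normc a = spectral_radius M.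
Proof.
move=> n_gt0.
have: spectrum M != [::].
  apply/eqP => s0; have := svalP (closed_field_poly_normal (char_poly M)).
  rewrite -/(spectrum M) s0 big_nil => /(congr1 (size \o polyseq)) /=.
  rewrite (monicP (char_poly_monic M)) scale1r size_char_poly size_poly1.
  by case=> n0; rewrite n0 in n_gt0.
suff H (s : seq R[i]) : s != [::] ->
    exists2 a, a \in s & ComplexField.Normc.normc a =
      \big[Num.max/0]_(a <- s) ComplexField.Normc.normc a.
  by move=> /H[a aM ea]; exists a; rewrite -?mem_spectrum.
have normc_ge0 (z : R[i]) : 0 <= ComplexField.Normc.normc z.
  by case: z => x y; rewrite sqrtr_ge0.
elim: s => // b [|c s] IHs _.
  by exists b; rewrite ?mem_head // big_seq1_id; apply/esym/max_idPl.
have [//|a a_s ea] := IHs; rewrite big_cons -ea.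
case: leP => _; last by exists b; rewrite ?mem_head.
by exists a; rewrite // inE a_s orbT.
Qed.

End SpectralRadius.

(* A is reducible when it is permutation similar to a block upper triangular
   matrix with two square diagonal blocks, of positive orders r and n - r.
   In particular every 1 x 1 matrix is irreducible. *)
Definition reducible_mx (R : realType) (n : nat) (A : 'M[R]_n) : Prop :=
  exists (P : 'M[R]_n) (r : nat),
    [/\ is_perm_mx P, (0 < r < n)%N &
        forall i j : 'I_n, (r <= i)%N -> (j < r)%N -> (P^T *m A *m P) i j = 0].

Definition irreducible_mx (R : realType) (n : nat) (A : 'M[R]_n) : Prop :=
  ~ reducible_mx A.

Definition offdiag_count (R : realType) (n : nat) (B : 'M[R]_n) (i : 'I_n) :
    nat :=
  #|[set j : 'I_n | (j != i) && (B i j != 0)]|.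

Definition col_bound (R : realType) (n : nat) (B : 'M[R]_n) (i : 'I_n) : R :=
  B i i +
  Num.sqrt (\sum_(k < n | k != i) (offdiag_count B k)%:R * B k i ^+ 2).

(* For a nonnegative matrix every col_bound B i is nonnegative, so the initial
   value 0 does not affect the maximum. *)
Definition max_col_bound (R : realType) (n : nat) (B : 'M[R]_n) : R :=
  \big[Num.max/0]_(i < n) col_bound B i.

(* Main.v *)
Require Import Defs.
From mathcomp Require Import all_boot all_order all_algebra.
From mathcomp Require Import complex reals.
From mathcomp Require Import fingroup perm ring lra.

Set Implicit Arguments.
Unset Strict Implicit.
Unset Printing Implicit Defensive.

Import Order.TTheory GRing.Theory Num.Theory.

Local Open Scope ring_scope.
Local Open Scope complex_scope.

(** Let [BX = rX] and let [y i] be the modulus of [X i 0].  The [i]th row of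
    the eigenvalue equation reads [(r - B i i) X i = \sum_(k != i) B i k X k],
    a sum with only [l_i] nonzero terms, so Cauchy-Schwarz gives
      [(r - B i i)^2 y_i^2 <= l_i \sum_(k != i) B i k ^+ 2 * y_k^2].
    Adding these inequalities over the rows and grouping the right-hand side by
    columns ([sum_offdiag_row_bound]) yields
      [\sum_k ((r - B k k)^2 - S_k) y_k^2 <= 0],
    where [S_k] is the expression under the square root in [col_bound B k].
    If [r] exceeded every column bound, all the coefficients would be positive,
    although some [y_k] is nonzero.  If [r] is the maximal column bound, all the
    coefficients are nonnegative, so every term vanishes: [r = col_bound B k]
    as soon as [y_k != 0].

    In the equality case the inequality of each row is an equality as well.
    Hence [y_i = 0] forces [B i k * y_k = 0] for all [k != i], that is,
    [B i k = 0] whenever [y_i = 0] and [y_k != 0].  The zero pattern of [X]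
    would then exhibit a block triangular form of [B]
    ([irreducible_no_closed_set]).  So if [B] is irreducible then [X] has no
    zero entry, and the equality of the column bounds on the support of [X]
    extends to all indices. *)

(** * Cauchy-Schwarz on a row *)

(** Expand the square and apply [2 a_j a_k <= a_j^2 + a_k^2] to each product. *)
Lemma sqr_sum_le_card (R : realFieldType) (I : finType) (A : {set I})
    (a : I -> R) :
  (\sum_(k in A) a k) ^+ 2 <= #|A|%:R * \sum_(k in A) a k ^+ 2.
Proof.
set Q := \sum_(k in A) a k ^+ 2.
have -> : #|A|%:R * Q =
    \sum_(j in A) \sum_(k in A) (a j ^+ 2 + a k ^+ 2) / 2.
  under eq_bigr do rewrite -mulr_suml big_split sumr_const /= -/Q.
  rewrite -mulr_suml big_split sumr_const /= -sumrMnl -/Q.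
  by under eq_bigr do rewrite -mulr_natl; rewrite -mulr_sumr -/Q; field.
rewrite expr2 mulr_suml; apply: ler_sum => j _.
rewrite mulr_sumr; apply: ler_sum => k _.
have := sqr_ge0 (a j - a k); lra.
Qed.

(** Only the [offdiag_count B i] nonzero entries of the row contribute, which is
    why this number, and not [n - 1], appears as the constant. *)
Lemma sqr_row_sum_le (R : realType) (n : nat) (B : 'M[R]_n) (y : 'I_n -> R)
    (i : 'I_n) :
  (\sum_(k < n | k != i) B i k * y k) ^+ 2 <=
  (offdiag_count B i)%:R * \sum_(k < n | k != i) B i k ^+ 2 * y k ^+ 2.
Proof.
have supp (F : 'I_n -> R) : (forall k, B i k = 0 -> F k = 0) ->
    \sum_(k < n | k != i) F k =
    \sum_(k in [set j : 'I_n | (j != i) && (B i j != 0)]) F k.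
  move=> F0; rewrite (bigID (fun k => B i k != 0)) /= [X in _ + X]big1.
    by rewrite addr0; apply: eq_bigl => k; rewrite inE.
  by move=> k /andP[_ /negPn/eqP/F0].
rewrite !supp => [|k ->|k ->]; rewrite ?expr0n ?mul0r //.
under [X in _ <= _ * X]eq_bigr do rewrite -exprMn.
exact: sqr_sum_le_card.
Qed.

(** * Summing the rows *)

(** The Cauchy-Schwarz bound for the square of [\sum_(k != i) B i k * y k]. *)
Definition offdiag_row_bound (R : realType) (n : nat) (B : 'M[R]_n)
    (y : 'I_n -> R) (i : 'I_n) : R :=
  (offdiag_count B i)%:R * \sum_(k < n | k != i) B i k ^+ 2 * y k ^+ 2.

Definition col_weight (R : realType) (n : nat) (B : 'M[R]_n) (k : 'I_n) : R :=
  \sum_(i < n | i != k) (offdiag_count B i)%:R * B i k ^+ 2.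

Lemma col_weight_ge0 (R : realType) (n : nat) (B : 'M[R]_n) (k : 'I_n) :
  0 <= col_weight B k.
Proof. by apply: sumr_ge0 => i _; rewrite mulr_ge0 ?sqr_ge0. Qed.

Lemma sum_offdiag_row_bound (R : realType) (n : nat) (B : 'M[R]_n)
    (y : 'I_n -> R) :
  \sum_(i < n) offdiag_row_bound B y i =
  \sum_(k < n) col_weight B k * y k ^+ 2.
Proof.
under eq_bigr do rewrite /offdiag_row_bound mulr_sumr.
rewrite (exchange_big_dep xpredT) //=; apply: eq_bigr => k _.
rewrite mulr_suml; apply: eq_big => [i|i _]; first by rewrite eq_sym.
by rewrite mulrA.
Qed.

Lemma col_bound_lt_sqr (R : realType) (n : nat) (B : 'M[R]_n) (r : R)
    (k : 'I_n) :
  col_bound B k < r -> col_weight B k < (r - B k k) ^+ 2.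
Proof.
rewrite /col_bound -/(col_weight B k) addrC -ltrBrDr => lt_r.
rewrite -(sqr_sqrtr (col_weight_ge0 B k)).
by apply: ltrXn2r; rewrite // sqrtr_ge0.
Qed.

Lemma col_bound_le_sqr (R : realType) (n : nat) (B : 'M[R]_n) (r : R)
    (k : 'I_n) :
  col_bound B k <= r -> col_weight B k <= (r - B k k) ^+ 2.
Proof.
rewrite le_eqVlt => /predU1P[<- | /col_bound_lt_sqr/ltW //].
by rewrite /col_bound addrAC subrr add0r sqr_sqrtr // col_weight_ge0.
Qed.

Section RowInequalities.
Variables (R : realType) (n : nat) (B : 'M[R]_n) (r : R) (y : 'I_n -> R).
Hypothesis row_le :
  forall i, (r - B i i) ^+ 2 * y i ^+ 2 <= offdiag_row_bound B y i.

Lemma sum_sqr_le :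
  \sum_(k < n) (r - B k k) ^+ 2 * y k ^+ 2 <=
  \sum_(k < n) col_weight B k * y k ^+ 2.
Proof. by rewrite -sum_offdiag_row_bound; apply: ler_sum. Qed.

(** Otherwise every coefficient [(r - B k k)^2 - col_weight B k] is positive,
    and the term of index [i] makes the weighted sum positive, against
    [sum_sqr_le]. *)
Lemma exists_col_bound_ge (i : 'I_n) :
  y i != 0 -> exists k, r <= col_bound B k.
Proof.
move=> yi_neq0; apply/existsP; apply: contraTT sum_sqr_le.
rewrite negb_exists => /forallP r_gt.
have lt_coef k : col_weight B k < (r - B k k) ^+ 2.
  by apply: col_bound_lt_sqr; rewrite ltNge r_gt.
rewrite -ltNge (bigD1 i) //= [X in _ < X](bigD1 i) //=.
apply: ltr_leD.
  by rewrite ltr_pM2r // lt_def sqr_ge0 sqrf_eq0 yi_neq0.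
by apply: ler_sum => k _; rewrite ler_wpM2r ?sqr_ge0 // ltW.
Qed.

Section EqualityCase.
Hypothesis r_ge : forall k, col_bound B k <= r.

Lemma term_le (k : 'I_n) :
  col_weight B k * y k ^+ 2 <= (r - B k k) ^+ 2 * y k ^+ 2.
Proof. by rewrite ler_wpM2r ?sqr_ge0 // col_bound_le_sqr. Qed.

Lemma sum_sqr_eq :
  \sum_(k < n) (r - B k k) ^+ 2 * y k ^+ 2 =
  \sum_(k < n) col_weight B k * y k ^+ 2.
Proof.
by apply/eqP; rewrite eq_le sum_sqr_le ler_sum // => k _; apply: term_le.
Qed.

(** The two sums of [sum_sqr_eq] agree term by term; a strict [col_bound B k < r]
    would make the terms of index [k] differ. *)
Lemma support_col_bound (k : 'I_n) : y k != 0 -> col_bound B k = r.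
Proof.
move=> yk_neq0; apply/eqP; rewrite eq_le r_ge leNgt; apply/negP => lt_r.
have := sum_sqr_eq; apply/eqP; rewrite gt_eqF // (bigD1 k) //=.
rewrite [X in _ < X](bigD1 k) //= ltr_leD //; last first.
  by apply: ler_sum => j _; apply: term_le.
by rewrite ltr_pM2r ?col_bound_lt_sqr // lt_def sqr_ge0 sqrf_eq0 yk_neq0.
Qed.

(** Once the sums over all rows agree, no row inequality can be strict. *)
Lemma row_eq (i : 'I_n) :
  (r - B i i) ^+ 2 * y i ^+ 2 = offdiag_row_bound B y i.
Proof.
have d_ge0 j : true ->
    0 <= offdiag_row_bound B y j - (r - B j j) ^+ 2 * y j ^+ 2.
  by rewrite subr_ge0 row_le.
have /eqP : \sum_j (offdiag_row_bound B y j - (r - B j j) ^+ 2 * y j ^+ 2) = 0.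
  by rewrite sumrB sum_offdiag_row_bound sum_sqr_eq subrr.
by rewrite psumr_eq0 // => /allP/(_ i (mem_index_enum i))/eqP/subr0_eq.
Qed.

(** Equality in the row [i] makes [offdiag_row_bound B y i] vanish.  If [B i k]
    were nonzero, the factor [offdiag_count B i] would be positive, so the sum
    of squares [B i j ^+ 2 * y j ^+ 2] would have to vanish termwise. *)
Lemma zero_row_support (i k : 'I_n) : y i = 0 -> y k != 0 -> B i k = 0.
Proof.
move=> yi0 yk_neq0; have neq_ki : k != i.
  by apply: contraNneq yk_neq0 => ->; rewrite yi0.
apply/eqP; apply: contraT => Bik_neq0.
have := row_eq i; rewrite yi0 expr0n mulr0 => /esym/eqP.
have count_neq0 : (offdiag_count B i)%:R != 0 :> R.
  rewrite pnatr_eq0 /offdiag_count cards_eq0.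
  by apply/set0Pn; exists k; rewrite inE neq_ki.
rewrite mulf_eq0 (negPf count_neq0) /= psumr_eq0 => [|j _]; last first.
  by rewrite mulr_ge0 ?sqr_ge0.
move=> /allP/(_ k (mem_index_enum k)); rewrite neq_ki /=.
by rewrite mulf_eq0 !sqrf_eq0 (negPf Bik_neq0) (negPf yk_neq0).
Qed.

End EqualityCase.
End RowInequalities.

(** * Irreducibility *)

(** Listing the indices outside [Z] first and those of [Z] last gives a
    permutation that makes the matrix block triangular. *)
Lemma irreducible_no_closed_set (R : realType) (n : nat) (B : 'M[R]_n)
    (Z : {set 'I_n}) :
  irreducible_mx B -> (forall i k, i \in Z -> k \notin Z -> B i k = 0) ->
  Z != setT -> Z = set0.
Proof.
move=> irrB Zclosed Z_neqT; apply/eqP; apply: contraT => Z_neq0.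
case: irrB; set s := enum (~: Z) ++ enum Z.
have size_s : size s = n.
  by rewrite size_cat -!cardE addnC cardsC card_ord.
have s_uniq : uniq s.
  rewrite cat_uniq !enum_uniq /= andbT; apply/hasPn => i.
  by rewrite !mem_enum inE negbK.
pose f (i : 'I_n) := nth i s i.
have f_inj : injective f.
  move=> i j /eqP; rewrite /f (set_nth_default i j) ?size_s //.
  by rewrite nth_uniq ?size_s // => /eqP/val_inj.
exists (perm_mx (perm f_inj)^-1), #|~: Z|; split.
- exact: perm_mx_is_perm.
- rewrite card_gt0 -(inj_eq (@setC_inj _)) setCK setC0 Z_neqT /=.
  rewrite -[X in (_ < X)%N]card_ord -(cardsC Z) -[ltnLHS]add0n ltn_add2r.
  by rewrite card_gt0.
move=> i j le_i lt_j.
rewrite tr_perm_mx invgK -row_permE -col_permE !mxE !permE.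
apply: Zclosed.
  rewrite /f nth_cat -cardE ltnNge le_i /= -mem_enum mem_nth //.
  by rewrite -cardE ltn_subLR // addnC cardsC card_ord.
rewrite /f nth_cat -cardE lt_j -in_setC -mem_enum mem_nth //.
by rewrite -cardE.
Qed.

(** * Passing to the moduli of the eigenvector *)

Lemma normcE (R : realType) (z : R[i]) :
  (ComplexField.Normc.normc z)%:C = `|z|.
Proof. by case: z. Qed.

(** Nonnegativity of [B] lets the triangle inequality replace the complex
    vector [X] by its moduli [y]; Cauchy-Schwarz does the rest. *)
Lemma eigenvector_row_le (R : realType) (n : nat) (B : 'M[R]_n) (r : R)
    (X : 'cV[R[i]]_n) (y := fun i => ComplexField.Normc.normc (X i 0)) :
  (forall i j, 0 <= B i j) ->
  map_mx (real_complex R) B *m X = r%:C *: X ->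
  forall i, (r - B i i) ^+ 2 * y i ^+ 2 <= offdiag_row_bound B y i.
Proof.
move=> B_ge0 BX i; apply: le_trans (sqr_row_sum_le B y i).
have row_i : (r - B i i)%:C * X i 0 = \sum_(k | k != i) (B i k)%:C * X k 0.
  move/matrixP: BX => /(_ i 0); rewrite !mxE (bigD1 i) //= mxE => e.
  rewrite rmorphB mulrBl /= -e addrAC subrr add0r.
  by apply: eq_bigr => k _; rewrite mxE.
have y_ge0 k : 0 <= y k by rewrite -ler0c normcE.
have normR (a : R) : `|a%:C| = `|a|%:C.
  by rewrite normc_def /= expr0n addr0 sqrtr_sqr.
have le_abs : `|r - B i i| * y i <= \sum_(k | k != i) B i k * y k.
  rewrite -lecR rmorphM rmorph_sum /= normcE -normR -normrM row_i.
  apply: le_trans (ler_norm_sum _ _ _) _; apply: ler_sum => k _.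
  by rewrite normrM normR (ger0_norm (B_ge0 i k)) rmorphM /= normcE.
rewrite -exprMn -[leLHS]real_normK ?num_real // normrM (ger0_norm (y_ge0 i)).
by rewrite lerXn2r // nnegrE ?mulr_ge0 // sumr_ge0 // => k _; rewrite mulr_ge0.
Qed.

Theorem theorem2p1 (R : realType) (n : nat) (B : 'M[R]_n) (X : 'cV[R[i]]_n)
    (BC := map_mx (real_complex R) B)
    (rho := spectral_radius BC)
    (B_ge0 : forall i j : 'I_n, 0 <= B i j)
    (X_neq0 : X != 0)
    (BX : BC *m X = rho%:C *: X) :
  [/\ rho <= max_col_bound B,
      rho = max_col_bound B ->
        forall i j : 'I_n, X i 0 != 0 -> X j 0 != 0 ->
          col_bound B i = col_bound B j &
      irreducible_mx B -> rho = max_col_bound B ->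
        forall i j : 'I_n, col_bound B i = col_bound B j].
Proof.
pose y i := ComplexField.Normc.normc (X i 0).
have y_eq0 i : (y i == 0) = (X i 0 == 0).
  by rewrite -(inj_eq (@complexI R)) normcE normr_eq0.
have row_le := eigenvector_row_le B_ge0 BX.
have bound_le k : col_bound B k <= max_col_bound B by apply: le_bigmax.
have [i0 Xi0_neq0] : exists i, X i 0 != 0.
  by have /cV0Pn := X_neq0.
have rho_supp : rho = max_col_bound B ->
    forall k, X k 0 != 0 -> col_bound B k = rho.
  move=> e k; rewrite -y_eq0; apply: support_col_bound row_le _ _ => j.
  by rewrite e.
split.
- have [|k le_k] := exists_col_bound_ge row_le (i := i0); first by rewrite y_eq0.
  exact: le_trans le_k (bound_le k).
- by move=> e i j Xi Xj; rewrite !rho_supp.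
move=> irrB e.
have Z0 : [set i | y i == 0] = set0.
  apply: irreducible_no_closed_set irrB _ _.
    move=> i k; rewrite !inE => /eqP yi yk.
    by apply: zero_row_support row_le _ _ _ yi yk => j; rewrite e.
  apply: contraNneq Xi0_neq0 => ZT; rewrite -y_eq0.
  by have := in_setT i0; rewrite -ZT inE.
have X_supp i : X i 0 != 0.
  by rewrite -y_eq0; have := in_set0 i; rewrite -Z0 inE => ->.
by move=> i j; rewrite !rho_supp.
Qed.
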